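(* Let $k\ge 3$ be an integer, let $q$ be any pattern of length $k$, and let $\alpha=12\cdots k$ be the monotone increasing pattern of length $k$. Then for every positive integer $n$, \[V_n(q)\le V_n(\alpha).\]
   Context: A pattern of length $k$ is a permutation $q=q_1q_2\cdots q_k$ of $\{1,\dots,k\}$ written in one-line notation; an $n$-permutation is a permutation $p=p_1p_2\cdots p_n$ of $\{1,\dots,n\}$. The permutation $p$ very tightly contains $q$ if there are integers $0\le i\le n-k$ and $0\le a\le n-k$ such that (i) for all indices $j,r\in\{1,\dots,k\}$, $q_j<q_r$ if and only if $p_{i+j}<p_{i+r}$, and (ii) $\{p_{i+1},\dots,p_{i+k}\}=\{a+1,\dots,a+k\}$. Otherwise $p$ very tightly avoids $q$ (in particular this is the case if $n<k$). $V_n(q)$ denotes the number of $n$-permutations that very tightly avoid $q$. *)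

(* Defs.v *)
From mathcomp Require Import all_boot all_fingroup.

Set Implicit Arguments.
Unset Strict Implicit.
Unset Printing Implicit Defensive.

(* Permutations are 0-based: an n-permutation is p : 'S_n, acting on
   {0, ..., n-1}, so the entry p_{m+1} of the usual one-line notation is
   (p m) + 1. The shift by one is the same for all positions and all values,
   and therefore affects neither the order condition nor the
   interval condition below. *)

Definition one_line n (p : 'S_n) : seq nat := [seq nat_of_ord (p x) | x : 'I_n].

Definition interval n (a k : nat) : {set 'I_n} := [set u : 'I_n | a <= u < a + k].

(* The constraints 0 <= i <= n - k and 0 <= a <= n - k are integer ones, hence
   stated as i + k <= n and a + k <= n: with truncated subtraction they would
   remain satisfiable (by 0) when n < k. They also ensure that the default
   value of nth is never used. *)
Definition very_tightly_contains n k (p : 'S_n) (q : 'S_k) : bool :=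
  [exists i : 'I_n.+1, exists a : 'I_n.+1,
    [&& i + k <= n,
        a + k <= n,
        [forall j : 'I_k, forall r : 'I_k,
           (q j < q r) ==
           (nth 0 (one_line p) (i + j) < nth 0 (one_line p) (i + r))]
      & p @: interval n i k == interval n a k]].

Definition very_tightly_avoids n k (p : 'S_n) (q : 'S_k) : bool :=
  ~~ very_tightly_contains p q.

Definition V n k (q : 'S_k) : nat := #|[set p : 'S_n | very_tightly_avoids p q]|.

(* Main.v *)
Require Import Defs.
From mathcomp Require Import all_boot all_fingroup zify.

(** Let X_q(p) be the number of very tight occurrences of q in p. The proof is
    a first and second moment comparison over all n-permutations p.

    An occurrence of q at position i and value a prescribes the k entries
    p(i + j) = a + q(j). Composing p with the permutation that acts as q on the
    block of positions turns an occurrence of the increasing pattern into one of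
    q, so the sum of X_q over all p is at least the corresponding sum for the
    increasing pattern ([card_occurs_id_le]). A permutation containing q
    contributes 1 to the number of permutations to be counted, and X_q(p) to that
    sum; what matters is therefore the sum of the excesses X_q(p) - 1.

    For the increasing pattern the excess is large: occurrences of the
    increasing pattern of length k + 1 are among those of length k, and the
    rightmost one of length k does not extend ([card_occurrences_id_ge]). With
    N = n - k, there are N^2 places for the longer pattern, each realised by at
    least (N - 1)! permutations, so the total excess is at least N^2 (N - 1)!.

    For any other q the excess is small: it is at most the number of pairs of
    occurrences of q ([card_occurrences_le]). If such a pair is shifted by d
    positions, comparing the sizes of the unions of the position blocks and of
    the value blocks shows that the values are shifted by d up or down when
    d < k, and by at least k when d >= k ([occurs_two_shift]). A shift by
    one position forces q to be monotone ([unit_shift_monotone]). For d >= 2 the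
    pair prescribes at least k + 2 entries, and as k >= 3 every choice of two
    positions carries at most 2 (N - 1)! pairs ([card_value_pairs]); there are at
    most N^2 / 2 such choices of positions, hence at most N^2 (N - 1)! pairs.

    The one remaining pattern, the decreasing one, reduces to the increasing one
    by complementing values. *)

(** * Blocks of consecutive integers and double counting *)

Lemma card_interval {n a k : nat} : a + k <= n -> #|interval n a k| = k.
Proof.
move=> le_n.
have lt_n (j : 'I_k) : a + j < n by have := ltn_ord j; lia.
have -> : interval n a k = [set Ordinal (lt_n j) | j : 'I_k].
  apply/setP => u; rewrite inE; apply/idP/imsetP.
    move=> /andP [le_a lt_a]; have lt_k : u - a < k by lia.
    by exists (Ordinal lt_k) => //; apply: val_inj => /=; lia.
  by case=> j _ -> /=; have := ltn_ord j; lia.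
rewrite card_imset ?card_ord // => j r [] e; apply: val_inj => /=; lia.
Qed.

Lemma card_union_intervals {n a b k : nat} :
  a + k <= n -> b + k <= n -> a <= b ->
  #|interval n a k :|: interval n b k| = k + minn (b - a) k.
Proof.
move=> ha hb ab.
have := cardsUI (interval n a k) (interval n b k).
have -> : interval n a k :&: interval n b k = interval n b (k - (b - a)).
  by apply/setP => u; rewrite !inE; lia.
rewrite !card_interval //; lia.
Qed.

Lemma card_sum_bool {T : finType} (P : pred T) :
  #|[set x | P x]| = \sum_x (P x : nat).
Proof. by rewrite -sum1_card big_mkcond; apply: eq_bigr => x _; rewrite inE; case: (P x). Qed.

Lemma sum_card_exchange {S T : finType} (P : S -> T -> bool) :
  \sum_x #|[set y | P x y]| = \sum_y #|[set x | P x y]|.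
Proof.
under eq_bigr do rewrite card_sum_bool.
by rewrite exchange_big; apply: eq_bigr => y _; rewrite card_sum_bool.
Qed.

(** * Occurrences by their entries *)

(** Since q lists 0, ..., k-1, the relative order and the interval of values
    together force every entry of an occurrence, which gives this pointwise
    form. *)
Definition occurs {n k : nat} (p : 'S_n) (q : 'S_k) (i a : nat) : bool :=
  [&& i + k <= n, a + k <= n &
   [forall j : 'I_k, forall x : 'I_n,
      (x == i + j :> nat) ==> (p x == a + q j :> nat)]].

Lemma occursP {n k : nat} {p : 'S_n} {q : 'S_k} {i a : nat} :
  reflect [/\ i + k <= n, a + k <= n &
              forall (j : 'I_k) (x : 'I_n), x = i + j :> nat -> p x = a + q j :> nat]
          (occurs p q i a).
Proof.
apply: (iffP and3P) => - [hi ha H]; split=> //.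
  move=> j x e; apply/eqP; move/forallP: H => /(_ j) /forallP /(_ x) /implyP.
  by apply; apply/eqP.
by apply/forallP => j; apply/forallP => x; apply/implyP => /eqP /H ->.
Qed.

Lemma occurs_image {n k : nat} {p : 'S_n} {q : 'S_k} {i a : nat} :
  occurs p q i a -> p @: interval n i k = interval n a k.
Proof.
case/occursP => hi ha H; apply/eqP; rewrite eqEcard; apply/andP; split.
  apply/subsetP => _ /imsetP [x + ->]; rewrite !inE => hx.
  have lt_k : x - i < k by lia.
  have := H (Ordinal lt_k) x; have := ltn_ord (q (Ordinal lt_k)) => /=; lia.
by rewrite card_imset ?card_interval //; apply: perm_inj.
Qed.

(** An entry of a permutation is the number of smaller entries, so it can be
    read off the order relation alone. *)
Lemma perm_eq_of_order {k : nat} (q s : 'S_k) :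
  (forall j r, (q j < q r) = (s j < s r)) -> q = s.
Proof.
have below (t : 'S_k) j : t j = #|[set r | t r < t j]| :> nat.
  rewrite -(card_imset _ (@perm_inj _ t)).
  have -> : [set t x | x in [set r | t r < t j]] = interval k 0 (t j).
    apply/setP => u; rewrite !inE /= add0n; apply/imsetP/idP.
      by case=> r; rewrite inE => ? ->.
    by move=> lt_u; exists ((t^-1)%g u); rewrite ?inE permKV.
  by rewrite card_interval // add0n ltnW.
move=> H; apply/permP => j; apply: val_inj => /=.
rewrite (below q) (below s); by apply: eq_card => r; rewrite !inE H.
Qed.

Lemma nth_one_line {n : nat} (p : 'S_n) (x : 'I_n) :
  nth 0 (one_line p) x = p x.
Proof. by rewrite /one_line (nth_map x) ?size_enum_ord // nth_ord_enum. Qed.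

(** For the direction from order to values, subtracting a from the entries of
    the block yields a permutation of {0, ..., k-1} that is ordered like q. *)
Lemma occursE {n k : nat} (p : 'S_n) (q : 'S_k) (i a : nat) :
  occurs p q i a =
  [&& i + k <= n, a + k <= n,
      [forall j : 'I_k, forall r : 'I_k,
         (q j < q r) ==
         (nth 0 (one_line p) (i + j) < nth 0 (one_line p) (i + r))]
    & p @: interval n i k == interval n a k].
Proof.
case hi: (i + k <= n); last by rewrite /occurs hi.
case ha: (a + k <= n); last by rewrite /occurs ha andbF.
have lt_n (j : 'I_k) : i + j < n by have := ltn_ord j; lia.
have nthE (j : 'I_k) : nth 0 (one_line p) (i + j) = p (Ordinal (lt_n j)).
  exact: (nth_one_line p (Ordinal (lt_n j))).
rewrite /=; apply/idP/andP; last case.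
  move=> occ; split=> //; last by rewrite (occurs_image occ).
  case/occursP: occ => _ _ H.
  apply/forallP => j; apply/forallP => r; rewrite !nthE.
  by rewrite (H j (Ordinal (lt_n j))) // (H r (Ordinal (lt_n r))) // ltn_add2l.
move=> /forallP ord /eqP im.
have inI (j : 'I_k) : a <= p (Ordinal (lt_n j)) < a + k.
  have : p (Ordinal (lt_n j)) \in interval n a k.
    by rewrite -im imset_f // inE /=; have := ltn_ord j; lia.
  by rewrite inE.
have lt_k (j : 'I_k) : p (Ordinal (lt_n j)) - a < k by have := inI j; lia.
have inj : injective (fun j => Ordinal (lt_k j)).
  move=> j r [] e; have : p (Ordinal (lt_n j)) = p (Ordinal (lt_n r)).
    by apply: val_inj => /=; have := inI j; have := inI r; lia.
  by move/perm_inj => [] er; apply: val_inj => /=; lia.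
have eq_q : q = perm inj.
  apply: perm_eq_of_order => j r; rewrite !permE /=.
  move/forallP: (ord j) => /(_ r) /eqP ->; rewrite !nthE.
  have := inI j; have := inI r; lia.
apply/occursP; split=> // j x ex; rewrite eq_q permE /=.
have -> : x = Ordinal (lt_n j) by apply: val_inj.
have := inI j; lia.
Qed.

Lemma very_tightly_containsE {n k : nat} (p : 'S_n) (q : 'S_k) :
  very_tightly_contains p q =
  [exists ia : 'I_n.+1 * 'I_n.+1, occurs p q ia.1 ia.2].
Proof.
apply/existsP/existsP.
  by case=> i /existsP [a]; rewrite -occursE => H; exists (i, a).
by case=> - [i a] /= H; exists i; apply/existsP; exists a; rewrite -occursE.
Qed.

Lemma occurs_contains {n k : nat} (p : 'S_n) (q : 'S_k) (i a : nat) :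
  occurs p q i a -> very_tightly_contains p q.
Proof.
move=> occ; case/occursP: (occ) => hi ha _.
have hi' : i < n.+1 by lia.
have ha' : a < n.+1 by lia.
rewrite very_tightly_containsE; apply/existsP.
by exists (Ordinal hi', Ordinal ha').
Qed.

(** * The number of occurrences in one permutation *)

Definition occurrences {n k : nat} (p : 'S_n) (q : 'S_k) :
  {set 'I_n.+1 * 'I_n.+1} := [set ia : 'I_n.+1 * 'I_n.+1 | occurs p q ia.1 ia.2].

Lemma occurs_value_unique {n k : nat} {p : 'S_n} {q : 'S_k} {i a b : nat} :
  0 < k -> occurs p q i a -> occurs p q i b -> a = b.
Proof.
move=> hk /occursP [hi _ Ha] /occursP [_ _ Hb].
have lt_n : i < n by lia.
have := Ha (Ordinal hk) (Ordinal lt_n); have := Hb (Ordinal hk) (Ordinal lt_n).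
rewrite /=; lia.
Qed.

(** An element ((i, i'), (a, a')) groups the two positions first and the two
    values last, so that sums over pairs split into positions and values. *)
Definition occurrence_pairs {n k : nat} (p : 'S_n) (q : 'S_k) :
  {set ('I_n.+1 * 'I_n.+1) * ('I_n.+1 * 'I_n.+1)} :=
  [set w : ('I_n.+1 * 'I_n.+1) * ('I_n.+1 * 'I_n.+1) |
    [&& w.1.1 < w.1.2, occurs p q w.1.1 w.2.1 & occurs p q w.1.2 w.2.2]].

(** Pairing the leftmost occurrence with each of the others gives X - 1 distinct
    pairs. *)
Lemma card_occurrences_le {n k : nat} (p : 'S_n) (q : 'S_k) :
  0 < k ->
  #|occurrences p q| <= very_tightly_contains p q + #|occurrence_pairs p q|.
Proof.
move=> hk; rewrite very_tightly_containsE.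
case: existsP => [[u0 hu0]|H]; last first.
  rewrite (_ : occurrences p q = set0) ?cards0 //.
  by apply/setP => u; rewrite !inE; apply/negP => hu; apply: H; exists u.
case: (@arg_minnP _ u0 (fun u => occurs p q u.1 u.2) (fun u => u.1) hu0).
move=> u hu umin.
rewrite (cardsD1 u) inE hu leq_add2l.
have inj : injective (fun v : 'I_n.+1 * 'I_n.+1 => ((u.1, v.1), (u.2, v.2))).
  by move=> [? ?] [? ?] [-> ->].
rewrite -(card_imset _ inj); apply: subset_leq_card.
apply/subsetP => _ /imsetP [v + ->]; rewrite !inE /= => /andP [neq hv].
rewrite hu hv !andbT ltn_neqAle umin // andbT.
apply: contra neq => /eqP e.
rewrite -pair_eqE /= -!val_eqE /= e eqxx /=.
by apply/eqP; move: hu; rewrite e => hu; apply: (occurs_value_unique hk hv hu).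
Qed.

Lemma occurs_id_prefix {n k : nat} {p : 'S_n} {i a : nat} :
  occurs p (1%g : 'S_k.+1) i a -> occurs p (1%g : 'S_k) i a.
Proof.
case/occursP => hi ha H; apply/occursP; split; try lia.
move=> j x e; rewrite perm1.
by have := H (widen_ord (leqnSn k) j) x e; rewrite perm1.
Qed.

Lemma occurs_id_suffix {n k : nat} {p : 'S_n} {i a : nat} :
  occurs p (1%g : 'S_k.+1) i a -> occurs p (1%g : 'S_k) i.+1 a.+1.
Proof.
case/occursP => hi ha H; apply/occursP; split; try lia.
move=> j x e; rewrite perm1.
have := H (lift ord0 j) x; rewrite perm1 /= /bump /=; lia.
Qed.

(** The rightmost occurrence of the increasing pattern of length k does not
    extend to length k + 1: if it did, there would be another one a step further
    to the right. *)
Lemma card_occurrences_id_ge {n k : nat} (p : 'S_n) :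
  very_tightly_contains p (1%g : 'S_k) + #|occurrences p (1%g : 'S_k.+1)|
    <= #|occurrences p (1%g : 'S_k)|.
Proof.
have sub : occurrences p (1%g : 'S_k.+1) \subset occurrences p (1%g : 'S_k).
  by apply/subsetP => u; rewrite !inE; apply: occurs_id_prefix.
rewrite very_tightly_containsE.
case: existsP => [[u0 hu0]|_]; last exact: subset_leq_card.
rewrite add1n; apply: proper_card; rewrite properE sub; apply/subsetPn.
case: (@arg_maxnP _ u0 (fun u => occurs p (1%g : 'S_k) u.1 u.2) (fun u => u.1) hu0).
move=> [i a] /= hu umax; exists (i, a); rewrite inE //=; apply/negP => hu'.
have occ := occurs_id_suffix hu'.
case/occursP: (hu') => hi ha _.
have hi' : i.+1 < n.+1 by lia.
have ha' : a.+1 < n.+1 by lia.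
by have := umax (Ordinal hi', Ordinal ha') occ; rewrite /= ltnn.
Qed.

(** * Permutations with prescribed entries *)

(** Multiplying by the inverse of one member p0 sends the members into the
    permutations fixing U pointwise. *)
Lemma card_agree_le {n : nat} (U : {set 'I_n}) (P : pred 'S_n) :
  (forall p p', P p -> P p' -> {in U, p =1 p'}) ->
  #|[set p | P p]| <= (n - #|U|)`!.
Proof.
move=> agree; case: (pickP P) => [p0 hp0|none]; last first.
  by rewrite (_ : [set p | P p] = set0) ?cards0 //; apply/setP => p; rewrite !inE none.
have -> : n - #|U| = #|~: U| by rewrite [in RHS]cardsCs setCK card_ord.
rewrite -card_perm -(card_imset _ (@mulIg _ (p0^-1)%g)).
apply: subset_leq_card; apply/subsetP => _ /imsetP [p + ->].
rewrite !inE => hp; apply/subsetP => x; rewrite inE permM => neq.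
rewrite inE; apply: contra neq => xU.
by rewrite (agree p p0 hp hp0 x xU) permK.
Qed.

Lemma card_agree_ge {n : nat} (U : {set 'I_n}) (p0 : 'S_n) :
  (n - #|U|)`! <= #|[set p : 'S_n | [forall x in U, p x == p0 x]]|.
Proof.
have -> : n - #|U| = #|~: U| by rewrite [in RHS]cardsCs setCK card_ord.
rewrite -card_perm -[X in X <= _](card_imset _ (@mulIg _ p0)).
apply: subset_leq_card; apply/subsetP => _ /imsetP [s hs ->].
rewrite inE; apply/forall_inP => x xU; rewrite permM (out_perm hs) //.
by rewrite inE negbK.
Qed.

(** A rotation of {0, ..., n-1} maps a block of consecutive positions, in order,
    to any chosen block of values: it wraps around only outside that block. *)
Lemma exists_rotation {n : nat} (c : nat) :
  exists p : 'S_n, forall x : 'I_n, p x = (x + c) %% n :> nat.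
Proof.
have lt_n (x : 'I_n) : (x + c) %% n < n.
  by rewrite ltn_mod; have := ltn_ord x; lia.
have inj : injective (fun x => Ordinal (lt_n x)).
  move=> x y [] /eqP; rewrite eqn_modDr !modn_small // => /eqP; exact: val_inj.
by exists (perm inj) => x; rewrite permE.
Qed.

Lemma card_occurs_id_ge {n k i a : nat} :
  i + k <= n -> a + k <= n ->
  (n - k)`! <= #|[set p : 'S_n | occurs p (1%g : 'S_k) i a]|.
Proof.
move=> hi ha; have [p0 Hp0] := @exists_rotation n (n + a - i).
rewrite -{1}(card_interval hi).
apply: (leq_trans (card_agree_ge _ p0)); apply: subset_leq_card.
apply/subsetP => p; rewrite !inE => /forall_inP H; apply/occursP; split=> // j x e.
have ltj := ltn_ord j.
have /H/eqP -> : x \in interval n i k by rewrite inE; lia.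
rewrite Hp0 perm1 (_ : x + _ = a + j + n); last by lia.
by rewrite modnDr modn_small //; lia.
Qed.

(** Extends q, transported to the block starting at i, by the identity outside
    the block. *)
Lemma exists_block_perm {n k : nat} (q : 'S_k) (i : nat) :
  i + k <= n ->
  exists t : 'S_n, forall (j : 'I_k) (x : 'I_n), x = i + j :> nat -> t x = i + q j :> nat.
Proof.
move=> hi.
(* The guard keeps the default 0 of nth out of reach. *)
pose g (x : nat) := if i <= x < i + k then i + nth 0 (one_line q) (x - i) else x.
have gin (j : 'I_k) : g (i + j) = i + q j.
  rewrite /g ifT; last by have := ltn_ord j; lia.
  by rewrite addKn nth_one_line.
have gout x : ~~ (i <= x < i + k) -> g x = x by rewrite /g => /negbTE ->.
have inP x : i <= x < i + k -> exists j : 'I_k, x = i + j.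
  move=> hx; have lt_k : x - i < k by lia.
  by exists (Ordinal lt_k) => /=; lia.
have gI x : (i <= g x < i + k) = (i <= x < i + k).
  case hx: (i <= x < i + k); last by rewrite gout ?hx.
  by have [j ->] := inP _ hx; rewrite gin; have := ltn_ord (q j); lia.
have lt_n (x : 'I_n) : g x < n.
  case hx: (i <= x < i + k); last by rewrite gout ?hx.
  by move: hx; rewrite -gI; lia.
have inj : injective (fun x => Ordinal (lt_n x)).
  move=> x y [] e; apply: val_inj => /=; move: (gI x); rewrite e gI.
  case hx: (i <= x < i + k) => hy; last by rewrite -(gout x) ?e ?gout ?hx ?hy.
  move: e; have [j ->] := inP _ hx; have [r ->] := inP _ hy.
  by rewrite !gin => /addnI/val_inj/perm_inj ->.
by exists (perm inj) => j x e; rewrite permE /= e gin.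
Qed.

(** Reordering the entries of the block by q is an injection from the
    permutations with an increasing block into those with a block ordered
    as q. *)
Lemma card_occurs_id_le {n k : nat} (q : 'S_k) (i a : nat) :
  #|[set p : 'S_n | occurs p (1%g : 'S_k) i a]| <=
  #|[set p : 'S_n | occurs p q i a]|.
Proof.
case hi: (i + k <= n); last first.
  by rewrite leq_eqVlt; apply/orP; left; apply/eqP; apply: eq_card => p; rewrite !inE /occurs hi.
have [t Ht] := @exists_block_perm n k q i hi.
rewrite -(card_imset _ (@mulgI _ t)).
apply: subset_leq_card; apply/subsetP => _ /imsetP [p + ->].
rewrite !inE => /occursP [_ ha H]; apply/occursP; split=> // j x e.
by rewrite permM (H (q j)) ?perm1 //; apply: Ht.
Qed.

(** * Two occurrences of the same pattern *)

(** Both sides are the size of a union of two blocks, minus k: blocks of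
    positions on the left, and their images under p, the blocks of values, on
    the right. *)
Lemma occurs_two_shift {n k : nat} {p : 'S_n} {q : 'S_k} {i a i' a' : nat} :
  i <= i' -> occurs p q i a -> occurs p q i' a' ->
  minn (i' - i) k = minn (maxn a a' - minn a a') k.
Proof.
move=> le_i o o'; have im := occurs_image o; have im' := occurs_image o'.
case/occursP: o => hi ha _; case/occursP: o' => hi' ha' _.
have := card_imset (interval n i k :|: interval n i' k) (@perm_inj _ p).
rewrite imsetU im im' (card_union_intervals hi hi') //.
case: (leqP a a') => le_a; first by rewrite card_union_intervals //; lia.
by rewrite setUC card_union_intervals //; lia.
Qed.

Lemma card_occurs_two_le {n k : nat} (q : 'S_k) (i a i' a' : nat) :
  i <= i' -> i' + k <= n ->
  #|[set p : 'S_n | occurs p q i a && occurs p q i' a']| <=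
    (n - k - minn (i' - i) k)`!.
Proof.
move=> le_i hi'; have hi : i + k <= n by lia.
rewrite -subnDA -(card_union_intervals hi hi') //.
have agree1 b c (p p' : 'S_n) : occurs p q b c -> occurs p' q b c ->
    {in interval n b k, p =1 p'}.
  move=> /occursP [_ _ H] /occursP [_ _ H'] x; rewrite inE => hx.
  have lt_k : x - b < k by lia.
  have ex : x = b + Ordinal lt_k :> nat by rewrite /=; lia.
  by apply: val_inj => /=; rewrite (H _ _ ex) (H' _ _ ex).
apply: card_agree_le => p p' /andP [o1 o2] /andP [o1' o2'] x.
by rewrite inE => /orP []; [apply: agree1 o1 o1' x | apply: agree1 o2 o2' x].
Qed.

Lemma leq_card_inj {T U : finType} (A : {set T}) (f : T -> U) :
  {in A &, injective f} -> #|A| <= #|U|.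
Proof. by move=> inj; rewrite -(card_in_imset inj); apply: max_card. Qed.

(** The maps (i, j) |-> (i, j - 1) and (i, j) |-> (j - 1, i) send the pairs with
    i + 2 <= j <= N to strictly increasing and to strictly decreasing pairs below
    N, so two copies of the set fit into the square of side N. *)
Lemma card_far_pairs (n N : nat) :
  2 * #|[set ij : 'I_n * 'I_n | (ij.1 + 2 <= ij.2) && (ij.2 <= N)]| <= N * N.
Proof.
set A := [set _ | _].
case: N @A => [|c] A.
  rewrite (_ : A = set0) ?cards0 //.
  by apply/setP => - [i j]; rewrite !inE /=; lia.
have -> : 2 * #|A| = #|setX [set: bool] A| by rewrite cardsX cardsT card_bool.
have -> : c.+1 * c.+1 = #|{: 'I_c.+1 * 'I_c.+1}| by rewrite card_prod card_ord.
pose f (x : bool * ('I_n * 'I_n)) : 'I_c.+1 * 'I_c.+1 :=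
  if x.1 then (inord x.2.1, inord x.2.2.-1) else (inord x.2.2.-1, inord x.2.1).
apply: (@leq_card_inj _ _ _ f) => - [b [i j]] [b' [i' j']].
rewrite !inE /= => /andP [h1 h2] /andP [h1' h2'].
have ord_eq (x y : 'I_n) : x = y :> nat -> x = y by apply: val_inj.
rewrite /f; case: b; case: b' => /= - [] /(congr1 val) /= e1 /(congr1 val) /= e2;
  move: e1 e2; rewrite !inordK; try lia; move=> e1 e2; try lia;
  by congr (_, (_, _)); apply: ord_eq; lia.
Qed.

(** For two occurrences shifted by d positions, the number of admissible pairs of
    values times the number of permutations realising one of them. If d < k, the
    order of the two values and the smaller one determine both, which gives
    2 (N - d + 1) (N - d)! = 2 (N - d + 1)!, enough as d >= 2. If d >= k, the
    smaller value and the larger one minus k are both at most N - k, which gives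
    2 (N - k + 1)^2 (N - k)! <= 2 (N - k + 2)!, and this is where k >= 3 is
    used. *)
Lemma card_value_pairs {n N k d : nat} :
  2 < k -> 1 < d <= N ->
  #|[set ab : 'I_n * 'I_n |
      [&& ab.1 <= N, ab.2 <= N &
          minn (maxn ab.1 ab.2 - minn ab.1 ab.2) k == minn d k]]|
    * (N - minn d k)`! <= 2 * (N.-1)`!.
Proof.
move=> hk /andP [hd dN]; set B := [set _ | _].
have ord_eq (x y : 'I_n) : x = y :> nat -> x = y by apply: val_inj.
case: (ltnP d k) => dk.
  have hB : #|B| <= 2 * (N - d).+1.
    have -> : 2 * (N - d).+1 = #|{: bool * 'I_(N - d).+1}|.
      by rewrite card_prod card_bool card_ord.
    apply: (@leq_card_inj _ _ _ (fun ab : 'I_n * 'I_n => (ab.1 < ab.2, inord (minn ab.1 ab.2)))).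
    move=> [a b] [a' b']; rewrite !inE /= => h h' [] lt_eq /(congr1 val) /=.
    rewrite !inordK; try lia; move=> e.
    by congr (_, _); apply: ord_eq; lia.
  apply: (@leq_trans (2 * (N - d).+1 * (N - d)`!)); first by rewrite leq_mul2r hB orbT.
  by rewrite -mulnA -factS leq_mul2l /=; apply: leq_fact; lia.
have hB : #|B| <= 2 * ((N - k).+1 * (N - k).+1).
  have -> : 2 * ((N - k).+1 * (N - k).+1) =
            #|{: bool * ('I_(N - k).+1 * 'I_(N - k).+1)}|.
    by rewrite !card_prod card_bool !card_ord.
  apply: (@leq_card_inj _ _ _ (fun ab : 'I_n * 'I_n =>
    (ab.1 < ab.2, (inord (minn ab.1 ab.2), inord (maxn ab.1 ab.2 - k))))).
  move=> [a b] [a' b']; rewrite !inE /= => h h' [] lt_eq /(congr1 val) /= e1 /(congr1 val) /= e2.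
  move: e1 e2; rewrite !inordK; try lia; move=> e1 e2.
  by congr (_, _); apply: ord_eq; lia.
apply: (@leq_trans (2 * ((N - k).+1 * (N - k).+1) * (N - k)`!)).
  by rewrite leq_mul2r hB orbT.
rewrite -!mulnA -factS leq_mul2l /=.
apply: (@leq_trans ((N - k).+2)`!); last by apply: leq_fact; lia.
by rewrite (factS (N - k).+1) leq_mul2r leqnSn orbT.
Qed.

Definition decreasing (k : nat) : 'S_k := perm (@rev_ord_inj k).

Lemma decreasingE {k : nat} (j : 'I_k) : decreasing k j = rev_ord j.
Proof. by rewrite permE. Qed.

(** The value blocks are then also shifted by one, and reading the same entry of
    p in both occurrences gives q(j + 1) = q(j) + 1 for all j, or
    q(j + 1) = q(j) - 1 for all j. *)
Lemma unit_shift_monotone {n k : nat} {p : 'S_n} {q : 'S_k} {i a b : nat} :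
  1 < k -> occurs p q i a -> occurs p q i.+1 b -> q = 1%g \/ q = decreasing k.
Proof.
move=> hk o o'; have := occurs_two_shift (leqnSn i) o o'.
case/occursP: o => hi ha H; case/occursP: o' => hi' hb H' shift.
have step (j : nat) (h : j < k) (h' : j.+1 < k) :
    a + q (Ordinal h') = b + q (Ordinal h).
  have lt_n : i + j.+1 < n by lia.
  have := H (Ordinal h') (Ordinal lt_n) erefl.
  have -> // := H' (Ordinal h) (Ordinal lt_n) _.
  by rewrite /= addnS.
have k0 : 0 < k by lia.
have k1 : k.-1 < k by lia.
have ab : b = a.+1 \/ a = b.+1 by lia.
case: ab => e; [left|right]; apply/permP => - [j hj]; apply: val_inj => /=.
  have lin m (hm : m < k) : q (Ordinal hm) = q (Ordinal k0) + m :> nat.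
    elim: m hm => [|m IH] hm; first by rewrite addn0; congr (nat_of_ord (q _)); apply: val_inj.
    have hm' : m < k by lia.
    by have := step m hm' hm; rewrite (IH hm'); lia.
  by rewrite perm1 lin /=; have := lin _ k1; have := ltn_ord (q (Ordinal k1)); lia.
have lin m (hm : m < k) : q (Ordinal hm) + m = q (Ordinal k0) :> nat.
  elim: m hm => [|m IH] hm; first by rewrite addn0; congr (nat_of_ord (q _)); apply: val_inj.
  have hm' : m < k by lia.
  by have := step m hm' hm; have := IH hm'; lia.
rewrite decreasingE /=; have := lin _ hj; have := lin _ k1.
by have := ltn_ord (q (Ordinal k0)); lia.
Qed.

(** * Comparison of the total excesses *)

(** At most N^2 / 2 pairs of positions at distance at least 2, with at most
    2 (N - 1)! occurrence pairs each. *)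
Lemma sum_occurrence_pairs_le {n k : nat} (q : 'S_k) :
  2 < k -> q <> 1%g -> q <> decreasing k ->
  \sum_(p : 'S_n) #|occurrence_pairs p q| <= (n - k) * (n - k) * ((n - k).-1)`!.
Proof.
move=> hk q1 qd; rewrite sum_card_exchange.
rewrite -(pair_bigA _ (fun ij ab : 'I_n.+1 * 'I_n.+1 => #|[set p : 'S_n |
  [&& ij.1 < ij.2, occurs p q ij.1 ab.1 & occurs p q ij.2 ab.2]]|)) /=.
set A := [set ij : 'I_n.+1 * 'I_n.+1 | (ij.1 + 2 <= ij.2) && (ij.2 <= n - k)].
have bound (ij : 'I_n.+1 * 'I_n.+1) :
    \sum_(ab : 'I_n.+1 * 'I_n.+1) #|[set p : 'S_n |
      [&& ij.1 < ij.2, occurs p q ij.1 ab.1 & occurs p q ij.2 ab.2]]|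
    <= (ij \in A) * (2 * ((n - k).-1)`!).
  case: ij => i j; rewrite inE /=.
  case far: ((i + 2 <= j) && (j <= n - k)); last first.
    rewrite mul0n leqn0 big1 // => - [a b] _ /=.
    rewrite (_ : [set p | _] = set0) ?cards0 //; apply/setP => p; rewrite !inE.
    apply/negP => /and3P [lt o o'].
    case/occursP: (o') => hj hb _.
    have ej : j = i.+1 :> nat by lia.
    rewrite ej in o'; have hk1 : 1 < k by lia.
    by case: (unit_shift_monotone hk1 o o').
  rewrite mul1n.
  have hd : 1 < j - i <= n - k by lia.
  apply: leq_trans (@card_value_pairs n.+1 (n - k) k (j - i) hk hd).
  set B := [set _ | _]; rewrite -sum_nat_const big_mkcond /=.
  rewrite [X in _ <= X]big_mkcond /=; apply: leq_sum => - [a b] _.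
  case hB: ((a, b) \in B).
    apply: leq_trans (card_occurs_two_le q i a j b _ _); try lia.
    by apply: subset_leq_card; apply/subsetP => p; rewrite !inE => /and3P [_ -> ->].
  rewrite leqn0 cards_eq0; apply/eqP/setP => p; rewrite !inE.
  apply/negP => /and3P [lt o o']; move/negP: hB; apply; rewrite inE /=.
  rewrite (occurs_two_shift (ltnW lt) o o') eqxx andbT.
case/occursP: o => _ ha _; case/occursP: o' => _ hb _; move: ha hb => /=; lia.
apply: leq_trans; first by apply: leq_sum => ij _; apply: bound.
rewrite -big_distrl /= -card_sum_bool.
have -> : [set ij | ij \in A] = A by apply/setP => ij; rewrite inE.
rewrite mulnA leq_mul2r mulnC card_far_pairs orbT //.
Qed.

(** N^2 places for the increasing pattern of length k + 1, each with at least
    (N - 1)! permutations. *)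
Lemma sum_occurrences_id_succ_ge {n k : nat} :
  (n - k) * (n - k) * ((n - k).-1)`! <=
  \sum_(p : 'S_n) #|occurrences p (1%g : 'S_k.+1)|.
Proof.
rewrite sum_card_exchange.
case e: (n - k) => [|c] //.
have -> : c.+1 * c.+1 = #|{: 'I_c.+1 * 'I_c.+1}| by rewrite card_prod card_ord.
have lt_n (j : 'I_c.+1) : j < n.+1 by have := ltn_ord j; lia.
pose f (x : 'I_c.+1 * 'I_c.+1) : 'I_n.+1 * 'I_n.+1 :=
  (Ordinal (lt_n x.1), Ordinal (lt_n x.2)).
have inj : injective f.
  by move=> [i a] [i' a'] [] e1 e2; congr (_, _); apply: val_inj.
rewrite -cardsT -(card_imset _ inj) -sum_nat_const.
rewrite [X in X <= _]big_mkcond; apply: leq_sum => ia _.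
case: imsetP => // - [[i a] _ ->] /=.
have := ltn_ord i; have := ltn_ord a => lta lti.
have ec : c = n - k.+1 by lia.
rewrite [X in X`!]ec; apply: card_occurs_id_ge; lia.
Qed.

Definition containing (n : nat) {k : nat} (q : 'S_k) : {set 'S_n} :=
  [set p : 'S_n | very_tightly_contains p q].

Lemma V_containing {n k : nat} (q : 'S_k) :
  V n q = #|{: 'S_n}| - #|containing n q|.
Proof.
rewrite /V cardsCs; congr (_ - _); apply: eq_card => p.
by rewrite !inE negbK.
Qed.

Lemma card_containing_id_le {n k : nat} (q : 'S_k) :
  2 < k -> q <> 1%g -> q <> decreasing k ->
  #|containing n (1%g : 'S_k)| <= #|containing n q|.
Proof.
move=> hk q1 qd.
have k0 : 0 < k by lia.
have lower : \sum_(p : 'S_n) #|occurrences p q| <=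
    #|containing n q| + \sum_(p : 'S_n) #|occurrence_pairs p q|.
  by rewrite card_sum_bool -big_split; apply: leq_sum => p _; apply: card_occurrences_le.
have upper : #|containing n (1%g : 'S_k)| +
    \sum_(p : 'S_n) #|occurrences p (1%g : 'S_k.+1)| <=
    \sum_(p : 'S_n) #|occurrences p (1%g : 'S_k)|.
  by rewrite card_sum_bool -big_split; apply: leq_sum => p _; apply: card_occurrences_id_ge.
have mean : \sum_(p : 'S_n) #|occurrences p (1%g : 'S_k)| <=
    \sum_(p : 'S_n) #|occurrences p q|.
  rewrite [X in X <= _]sum_card_exchange [X in _ <= X]sum_card_exchange.
  by apply: leq_sum => ia _; apply: card_occurs_id_le.
have := @sum_occurrence_pairs_le n k q hk q1 qd.
have := @sum_occurrences_id_succ_ge n k.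
move: lower upper mean.
set s1 := \sum_p _; set s2 := \sum_p _; set s3 := \sum_p _; set s4 := \sum_p _.
set c := (_ * _)%N.
lia.
Qed.

(** * The decreasing pattern *)

(** Multiplication on the right by the decreasing permutation complements
    values, and the lowest value a of the block becomes n - 1 - (a + k - 1). *)
Lemma occurs_complement {n k : nat} {p : 'S_n} {q : 'S_k} {i a : nat} :
  occurs p q i a -> occurs (p * decreasing n)%g (q * decreasing k)%g i (n - k - a).
Proof.
case/occursP => hi ha H; apply/occursP; split; try lia.
move=> j x /H e; rewrite !permM !decreasingE /= e.
have := ltn_ord (q j); lia.
Qed.

Lemma V_decreasing_le {n k : nat} : V n (decreasing k) <= V n (1%g : 'S_k).
Proof.
rewrite /V -(card_imset _ (@mulIg _ (decreasing n))).
have square m : (decreasing m * decreasing m)%g = 1%g.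
  by apply/permP => x; rewrite permM !decreasingE rev_ordK perm1.
apply: subset_leq_card; apply/subsetP => _ /imsetP [p + ->].
rewrite !inE; apply: contra; rewrite very_tightly_containsE => /existsP [ia] o.
have := occurs_complement o; rewrite -mulgA square mulg1 mul1g.
exact: occurs_contains.
Qed.

(* The identity 1%g of 'S_k is the increasing pattern 12...k. *)
Theorem theorem1 (k : nat) (hk : 3 <= k) (q : 'S_k) (n : nat) (hn : 0 < n) :
  V n q <= V n (1%g : 'S_k).
Proof.
have [->|q1] := eqVneq q 1%g; first exact: leqnn.
have [->|qd] := eqVneq q (decreasing k); first exact: V_decreasing_le.
by rewrite !V_containing leq_sub2l // card_containing_id_le //; apply/eqP.
Qed.
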